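(* Let $(G,\ell)$ be a finite connected graph with positive edge resistances containing an edge $e=uv$, and let $(H,\ell')$ be obtained from $G$ by subdividing $e$: delete $e$, add a new vertex $x$ and new edges $e_1=ux$, $e_2=xv$ with positive resistances satisfying $\ell'_{e_1}+\ell'_{e_2}=\ell_e$, all other resistances unchanged. Then $K^G_e=K^H_{e_1}+K^H_{e_2}$.
   Context: For vertices $x,y$ of a finite connected graph with positive resistances, the effective resistance is $\omega_{xy}=\tau(G/xy;\ell)/\tau(G;\ell)$, where $G/xy$ is obtained by identifying $x$ and $y$, and $\tau(H;\ell)=\sum_T\prod_{f\notin T}\ell_f$ over spanning trees $T$ of $H$. For an edge $e=uv$ of a graph $G$, the Ricci--Foster curvature is $K^G_e=\frac{1}{\deg_u}+\frac{1}{\deg_v}-\frac{\omega_{uv}}{\ell_e}$, where $\deg_u$ is the number of edges incident to $u$ in $G$. *)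

(* Defs.v *)
From HB Require Import structures.
From mathcomp Require Import all_boot all_order all_algebra.

Set Implicit Arguments.
Unset Strict Implicit.
Unset Printing Implicit Defensive.

Import GRing.Theory Num.Theory.
Local Open Scope ring_scope.

(* Finite graphs, with parallel edges and loops allowed: identifying two      *)
(* vertices creates both.  The orientation of an edge from [src] to [tgt] is  *)
(* an arbitrary way of naming its endpoints.                                  *)
Record graph := Graph {
  vertex : finType;
  edge : finType;
  src : edge -> vertex;
  tgt : edge -> vertex }.

Section Graphs.
Variable G : graph.
Implicit Types (x y u : vertex G) (f : edge G) (T : {set edge G}).

Definition adjacent T : rel (vertex G) :=
  fun x y => [exists f in T, ((src f == x) && (tgt f == y))
                          || ((src f == y) && (tgt f == x))].

Definition spans T : bool := [forall x, forall y, connect (adjacent T) x y].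

Definition connected : bool := spans [set: edge G].

(* An edge together with a direction of travel; [true] goes from [tgt] to     *)
(* [src].                                                                     *)
Definition dart : finType := (edge G * bool)%type.
Definition dart_from (d : dart) := if d.2 then tgt d.1 else src d.1.
Definition dart_to (d : dart) := if d.2 then src d.1 else tgt d.1.

(* Distinctness of both vertices and edges makes a loop a cycle of length 1   *)
(* and a pair of parallel edges a cycle of length 2, but excludes going back  *)
(* and forth along one edge.                                                  *)
Definition is_cycle (c : seq dart) : bool :=
  [&& c != [::], cycle (fun d d' => dart_to d == dart_from d') c,
      uniq (map dart_from c) & uniq (map fst c)].

(* The edges of a cycle are distinct, so bounding its length by the number of *)
(* edges loses nothing.                                                       *)
Definition acyclic T : bool :=
  ~~ [exists c : #|edge G|.-bseq dart,
        is_cycle c && all (fun d : dart => d.1 \in T) c].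

Definition spanning_tree T : bool := spans T && acyclic T.

(* A loop counts twice. *)
Definition deg u : nat :=
  (#|[set f | src f == u]| + #|[set f | tgt f == u]|)%N.

Definition merge_to x y z := if z == y then x else z.

(* The classes of the identification are represented by the values of         *)
(* [merge_to x y]; all edges are kept.                                        *)
Definition identify x y : graph :=
  let proj z : {w | w \in codom (merge_to x y)} :=
    exist _ (merge_to x y z) (codom_f (merge_to x y) z) in
  @Graph {w | w \in codom (merge_to x y)} (edge G)
    (fun f => proj (src f)) (fun f => proj (tgt f)).

(* The new vertex is [None]; the new edges are [inr false], from [src e] to   *)
(* [None], and [inr true], from [None] to [tgt e].                            *)
Definition subdivide (e : edge G) : graph :=
  @Graph (option (vertex G)) ({f : edge G | f != e} + bool)%type
    (fun h => match h with
              | inl f0 => Some (src (val f0))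
              | inr false => Some (src e)
              | inr true => None
              end)
    (fun h => match h with
              | inl f0 => Some (tgt (val f0))
              | inr false => None
              | inr true => Some (tgt e)
              end).

Definition sub_old (e : edge G) (f : {f : edge G | f != e}) :
  edge (subdivide e) := inl f.
Definition sub_edge1 (e : edge G) : edge (subdivide e) := inr false.
Definition sub_edge2 (e : edge G) : edge (subdivide e) := inr true.

End Graphs.

Arguments sub_edge1 {G} e.
Arguments sub_edge2 {G} e.

Section Resistance.
Variable R : realFieldType.

Definition tau (G : graph) (l : edge G -> R) : R :=
  \sum_(T : {set edge G} | spanning_tree T) \prod_(f | f \notin T) l f.

(* For [x = y] there is nothing to identify and the quotient would be 1; the  *)
(* resistance between a vertex and itself is 0.                               *)
Definition eff_res (G : graph) (l : edge G -> R) (x y : vertex G) : R :=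
  if x == y then 0 else @tau (identify x y) l / tau l.

Definition ricci_foster (G : graph) (l : edge G -> R) (e : edge G) : R :=
  (deg (src e))%:R^-1 + (deg (tgt e))%:R^-1 - eff_res l (src e) (tgt e) / l e.

End Resistance.

(* Main.v *)
(* For every edge e, the ratio omega_e / l_e is the probability that e lies   *)
(* in a random spanning tree T of weight prod_(f notin T) l_f: removing e is  *)
(* a bijection from the trees through e to the trees of the graph with the    *)
(* ends of e identified (for a loop, both numbers are 0).                     *)
(* Let A be the weight of the trees of G through e and                        *)
(* l_e B that of the others.  Merging the pieces of e, where e is kept iff    *)
(* both e1 and e2 are present, shows that in H the trees through both e1 and  *)
(* e2 have weight A, those through e1 alone l_e2 B, and those through e2      *)
(* alone l_e1 B.  Hence tau H = tau G = A + l_e B, and                        *)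
(* omega_e1 / l_e1 + omega_e2 / l_e2 = (2 A + l_e B) / tau                    *)
(* = omega_e / l_e + 1, where the 1 is cancelled by the two terms 1/2 coming  *)
(* from the new vertex of degree 2.                                           *)

Require Import Defs.
From mathcomp Require Import all_boot all_order all_algebra zify ring.
Import Order.TTheory GRing.Theory Num.Theory.
Local Open Scope ring_scope.

Set Implicit Arguments.
Unset Strict Implicit.
Unset Printing Implicit Defensive.

(** Put the two new edges together into [e]. A random spanning tree of the subdivision becomes one
    of the original graph with the same law, and it contains two new edges if the merged tree
    contains [e], one otherwise. So the shares of trees through the new edges add up to 1 plus the
    share through [e], and the 1 is the degree contribution of the new vertex. [eff_res_through]
    identifies omega/l with these shares. [sum_split_pieces] weighs the trees of the subdivision
    according to the new edges they contain. [spanning_tree_min] describes trees by connectivity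
    alone, so that cycles need not be followed through identification and subdivision. *)

Lemma connect_homo (T T' : finType) (r : rel T) (r' : rel T') (h : T -> T') :
    (forall x y, r x y -> connect r' (h x) (h y)) ->
  forall x y, connect r x y -> connect r' (h x) (h y).
Proof.
move=> hr x _ /connectP[p rp ->].
elim: p x rp => [|z p IHp] x /=; first by rewrite connect0.
by case/andP=> /hr hxz /IHp; apply: connect_trans.
Qed.

(** * Spanning trees as minimal spanning edge sets *)

Section Connectivity.
Variable G : graph.
Implicit Types (x y : vertex G) (f : edge G) (S T : {set edge G}) (d : dart G).

Definition chained d d' := dart_to d == dart_from d'.

Lemma adjacentP T x y :
  reflect (exists2 d : dart G, d.1 \in T & dart_from d = x /\ dart_to d = y)
          (adjacent T x y).
Proof.
apply: (iffP existsP) => [[f /andP[Tf /orP[]/andP[/eqP<- /eqP<-]]]|].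
- by exists (f, false).
- by exists (f, true).
case=> -[f b] /= Tf [<- <-]; exists f; rewrite Tf /dart_from /dart_to /=.
by case: b; rewrite !eqxx ?orbT.
Qed.

Lemma connectE_sym T : connect_sym (adjacent T).
Proof.
apply: sym_connect_sym => x y; apply/adjacentP/adjacentP.
  by case=> -[f b] Tf [<- <-]; exists (f, ~~ b) => //; case: b {Tf}.
by case=> -[f b] Tf [<- <-]; exists (f, ~~ b) => //; case: b {Tf}.
Qed.

Lemma connect_edge T f : f \in T -> connect (adjacent T) (src f) (tgt f).
Proof. by move=> Tf; apply: connect1; apply/adjacentP; exists (f, false). Qed.

Lemma connect_homo_edges (V : finType) (r : rel V) (h : vertex G -> V) T :
    connect_sym r -> {in T, forall f, connect r (h (src f)) (h (tgt f))} ->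
  forall x y, connect (adjacent T) x y -> connect r (h x) (h y).
Proof.
move=> r_sym hT; apply: connect_homo => _ _ /adjacentP[[f b] /= /hT Tf [<- <-]].
by case: b; rewrite // r_sym.
Qed.

Lemma spansP T : reflect (forall x y, connect (adjacent T) x y) (spans T).
Proof. by apply: (iffP forallP) => h x; apply/forallP. Qed.

Lemma spansD1 T f :
  spans T -> connect (adjacent (T :\ f)) (src f) (tgt f) -> spans (T :\ f).
Proof.
move=> /spansP spT con_f; apply/spansP=> x y.
apply: (connect_homo_edges (h := id)) (spT x y) => [|g Tg].
  exact: connectE_sym.
by have [->//|gf] := eqVneq g f; apply: connect_edge; rewrite in_setD1 gf.
Qed.

Lemma connect_darts T d s :
    path chained d s -> all (fun d' : dart G => d'.1 \in T) s ->
  connect (adjacent T) (dart_to d) (dart_to (last d s)).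
Proof.
elim: s d => [|d' s IHs] d /=; first by rewrite connect0.
case/andP=> /eqP-> path_s /andP[Td' Ts]; apply: connect_trans (IHs _ path_s Ts).
by apply: connect1; apply/adjacentP; exists d'.
Qed.

(** The quantified dart [d] entering [x] lets one statement express the endpoints even when the path
    [c] is empty. *)
Lemma simple_darts T x y :
    connect (adjacent T) x y ->
  exists c : seq (dart G),
    [/\ forall d, dart_to d = x -> path chained d c /\ dart_to (last d c) = y,
        all (fun d : dart G => d.1 \in T) c,
        uniq (rcons (map (@dart_from G) c) y)
      & uniq (map fst c)].
Proof.
case/connectP=> p0 /shortenP[p Tp Up _] -> {p0}.
suff [c [cP Tc def_p _ Uc]]: exists c : seq (dart G),
    [/\ forall d, dart_to d = x ->
          path chained d c /\ dart_to (last d c) = last x p,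
        all (fun d : dart G => d.1 \in T) c,
        map (@dart_from G) c = belast x p, map (@dart_to G) c = p
      & uniq (map fst c)].
  by exists c; rewrite def_p -lastI.
elim: p x Tp Up => [|z p IHp] x /=; first by exists [::].
case/andP=> /adjacentP[d Td [def_x def_z]] Tp /andP[x_p Up].
have [c [cP Tc def_p1 def_p2 Uc]] := IHp z Tp Up.
exists (d :: c); split=> [d' def_d'||||] /=.
- by rewrite /chained def_d' def_x eqxx; apply: cP.
- by rewrite Td.
- by rewrite def_x def_p1.
- by rewrite def_z def_p2.
(* If the edge of [d] occurred again later, its starting point [x] would be revisited. *)
rewrite Uc andbT; apply: contra x_p => /mapP[d' cd' eq_d].
have: dart_from d' \in z :: p.
  by apply: mem_belast; rewrite -def_p1 map_f.
have: dart_to d' \in z :: p.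
  by rewrite inE -def_p2 map_f ?orbT.
rewrite -def_x; move: eq_d; case: (d) (d') => f b [f' b'] /= -> {cd'}.
by rewrite /dart_from /dart_to /=; case: b b' => [] [].
Qed.

(** If [f] is redundant, a simple path between its ends avoiding [f] closes up with [f] to a cycle;
    conversely, an edge of a cycle can be bypassed along the rest of it. *)
Lemma spanning_tree_min T :
  spanning_tree T = spans T && [forall f in T, ~~ spans (T :\ f)].
Proof.
rewrite /spanning_tree; case spT: (spans T) => //=; rewrite /acyclic negb_exists.
apply/forallP/forall_inP=> [acT f Tf | minT c].
  apply/negP=> /spansP/(_ (tgt f) (src f)) /simple_darts[c [cP Tc Uv Ue]].
  have [path_c last_c] := cP (f, false) erefl.
  have Uec: uniq (map fst ((f, false) :: c)).
    rewrite /= Ue andbT; apply/negP=> /mapP[d cd def_f].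
    by have:= allP Tc d cd; rewrite -def_f !inE eqxx.
  have sz_c: (size ((f, false) :: c) <= #|edge G|)%N.
    by rewrite -(size_map fst) -(card_uniqP Uec) max_card.
  have:= acT (Bseq sz_c); rewrite /is_cycle Uec /= rcons_path path_c Tf /=.
  rewrite /chained last_c eqxx /= -rcons_uniq Uv /=.
  by case/negP; apply: sub_all Tc => d; rewrite inE => /andP[].
apply/negP=> /andP[/and4P[]]; case: (bseqval c) => // d s _ /= cyc_s _.
case/andP=> d_s _ /andP[Td Ts]; case/negP: (minT _ Td).
apply: spansD1 => //; move: cyc_s; rewrite rcons_path => /andP[path_s /eqP last_s].
have: connect (adjacent (T :\ d.1)) (dart_to d) (dart_to (last d s)).
  apply: connect_darts path_s _; apply/allP=> d' sd'.
  rewrite in_setD1 (allP Ts) // andbT; apply: contraNneq d_s => <-.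
  exact: map_f.
rewrite last_s; case: (d) => f [] /=; rewrite /dart_to /dart_from //=.
by rewrite connectE_sym.
Qed.

Lemma spanning_tree_spans T : spanning_tree T -> spans T.
Proof. by case/andP. Qed.

Lemma spanning_tree_minimal T f : spanning_tree T -> f \in T -> ~~ spans (T :\ f).
Proof. by rewrite spanning_tree_min => /andP[_ /forall_inP]; apply. Qed.

Lemma exists_spanning_tree : connected G -> exists T, @spanning_tree G T.
Proof.
move=> conG; have [T /minsetP[spT minT] _] := @minset_exists _ (@spans G) _ conG.
exists T; rewrite spanning_tree_min spT; apply/forall_inP=> f Tf; apply/negP=> spTf.
by move: Tf; rewrite -(minT _ spTf (subD1set _ _)) !inE eqxx.
Qed.

End Connectivity.

(** * Effective resistance as the share of trees through an edge *)

Section Contraction.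
Variables (G : graph) (e : edge G).
Implicit Types (T : {set edge G}).
Let Q := identify (src e) (tgt e).
Let proj z : vertex Q :=
  exist _ (merge_to (src e) (tgt e) z) (codom_f (merge_to (src e) (tgt e)) z).

Lemma connect_val_proj T z : connect (adjacent (e |: T)) (val (proj z)) z.
Proof.
rewrite /= /merge_to; case: eqP => [->|_]; last exact: connect0.
by rewrite connect_edge ?setU11.
Qed.

Lemma connect_identify T x y :
  connect (@adjacent Q T) (proj x) (proj y) = connect (adjacent (e |: T)) x y.
Proof.
apply/idP/idP=> [con_xy | ].
  rewrite -(same_connect (@connectE_sym _ _) (connect_val_proj T x)).
  rewrite -(same_connect_r (@connectE_sym _ _) (connect_val_proj T y)).
  apply: (@connect_homo_edges Q _ _ val) con_xy => [|f Tf].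
    exact: connectE_sym.
  rewrite (same_connect (@connectE_sym _ _) (connect_val_proj T _)).
  rewrite (same_connect_r (@connectE_sym _ _) (connect_val_proj T _)).
  by rewrite connect_edge ?setU1r.
apply: (connect_homo_edges (h := proj)) => [|f]; first exact: connectE_sym.
case/setU1P=> [->|Tf]; last exact: (@connect_edge Q).
suff ->: proj (src e) = proj (tgt e) by apply: connect0.
by apply: val_inj; rewrite /= /merge_to eqxx; case: ifP.
Qed.

Lemma spans_identify T : @spans Q T = spans (e |: T).
Proof.
apply/spansP/spansP=> spT x y; first by rewrite -connect_identify; apply: spT.
have proj_val z : z = proj (iinv (valP z)).
  by apply: val_inj; rewrite /= f_iinv.
by rewrite (proj_val x) (proj_val y) connect_identify.
Qed.

Lemma spanning_tree_identify T :
    src e != tgt e -> e \in T ->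
  @spanning_tree Q (T :\ e) = spanning_tree T.
Proof.
move=> not_loop Te; rewrite !spanning_tree_min spans_identify setD1K //.
case spT: (spans T) => //=.
have spTf f : f != e -> @spans Q (T :\ e :\ f) = spans (T :\ f).
  move=> fe; rewrite spans_identify; congr spans; apply/setP=> g.
  rewrite !inE; have [->|//] := eqVneq g e.
  by rewrite eq_sym fe.
apply/forall_inP/forall_inP=> minT f; last first.
  by case/setD1P=> fe Tf; rewrite spTf // minT.
have [->{f} _|fe Tf] := eqVneq f e; last by rewrite -spTf // minT // in_setD1 fe.
(* A path from [src e] to [tgt e] avoiding [e] becomes a closed walk in the   *)
(* quotient, so its first edge is redundant there.                            *)
apply/negP=> /spansP/(_ (src e) (tgt e))/simple_darts[[|d c] [cP Tc _ Ue]].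
  by have [_ /eqP] := cP (e, true) erefl; rewrite (negPf not_loop).
have [/= /andP[/eqP from_d path_c] last_c] := cP (e, true) erefl.
have /= /andP[/setD1P[de Td] Tc'] := Tc.
suff: spans (T :\ d.1).
  by rewrite -spTf // (negPf (minT _ _)) // in_setD1 de.
have: connect (adjacent (T :\ d.1)) (dart_to d) (tgt e).
  rewrite -last_c; apply: connect_darts path_c _; apply/allP=> d' cd'.
  have /setD1P[_ Td'] := allP Tc' _ cd'; rewrite in_setD1 Td' andbT.
  by case/andP: Ue => d_c _; apply: contraNneq d_c => <-; apply: map_f.
rewrite connectE_sym => con_d; apply: spansD1 => //.
have: connect (adjacent (T :\ d.1)) (dart_from d) (dart_to d).
  rewrite -from_d; apply: connect_trans con_d.
  by apply: connect_edge; rewrite in_setD1 eq_sym de.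
by case: (d) => f [] //=; rewrite connectE_sym.
Qed.

Variables (R : realFieldType) (l : edge G -> R).
Hypothesis l_pos : forall f, 0 < l f.

Definition tau_through : R :=
  \sum_(T : {set edge G} | spanning_tree T && (e \in T)) \prod_(f | f \notin T) l f.

Lemma eff_res_through :
  eff_res l (src e) (tgt e) / l e = tau_through / tau l.
Proof.
rewrite /eff_res; case: eqVneq => [loop_e | not_loop].
  (* No spanning tree contains a loop, which agrees with the default value 0 of [eff_res]. *)
  rewrite mul0r /tau_through big_pred0 ?mul0r // => T; apply/andP=> -[trT Te].
  case/negP: (spanning_tree_minimal trT Te); apply: spansD1.
    exact: spanning_tree_spans.
  by rewrite loop_e connect0.
rewrite mulrAC; congr (_ / _); rewrite /tau.
(* Adding [e] back is inverse to removing it because [e] is a loop in the quotient, hence in none of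
   its trees. *)
rewrite (reindex_onto (fun T => T :\ e) (fun T => e |: T)) /=; last first.
  move=> S trS; apply/setP=> f; rewrite !inE; case: eqVneq => //= ->.
  apply/esym/negP=> Se; case/negP: (spanning_tree_minimal trS Se).
  rewrite spans_identify setD1K // -(setUidPr (_ : [set e] \subset S)) ?sub1set //.
  by rewrite -spans_identify spanning_tree_spans.
rewrite mulr_suml; apply: eq_big => [T | T /andP[_ /eqP def_T]].
  have [Te|Te] := boolP (e \in T).
    by rewrite setD1K // eqxx spanning_tree_identify.
  rewrite andbF; apply/negP=> /andP[_ /eqP def_T].
  by rewrite -def_T setU11 in Te.
(* The quotient tree misses [e]; the resulting factor [l e] is the one divided out. *)
rewrite (bigD1 e) /=; last by rewrite !inE eqxx.
rewrite mulrC mulKf; last exact: lt0r_neq0.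
apply: eq_bigl => f.
rewrite !inE; case: eqVneq => [->|_] /=; last by rewrite andbT.
by rewrite -def_T setU11.
Qed.

Lemma tau_gt0 : connected G -> 0 < tau l.
Proof.
case/exists_spanning_tree=> T trT; rewrite /tau (bigD1 T) //=.
have pos_prod (S : {set edge G}) : 0 < \prod_(f | f \notin S) l f.
  exact: prodr_gt0.
by rewrite ltr_wpDr // sumr_ge0 // => S _; apply: ltW.
Qed.

End Contraction.

(** * Spanning trees of the subdivided graph *)

Section Subdivision.
Variables (G : graph) (e : edge G).
Let H := subdivide e.

Definition base (h : edge H) : edge G := if h is inl g then val g else e.

Definition merge_pieces (T : {set edge H}) : {set edge G} :=
  [set f | [forall h, (base h == f) ==> (h \in T)]].

Lemma in_merge_pieces T f :
  (f \in merge_pieces T) =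
    if insub f is Some g then inl g \in T
    else (sub_edge1 e \in T) && (sub_edge2 e \in T).
Proof.
rewrite inE; case: insubP => [g fe def_f | /negPn/eqP->].
  apply/forallP/idP=> [/(_ (inl g))/=|Tg [g'|b] /=].
  - by rewrite def_f eqxx.
  - by rewrite -def_f; apply/implyP=> /eqP/val_inj->.
  - by rewrite eq_sym (negPf fe).
apply/forallP/andP=> [T_e | [T1 T2] [g|[]] /=]; rewrite ?eqxx //.
  by split; [have := T_e (sub_edge1 e) | have:= T_e (sub_edge2 e)]; rewrite /= eqxx.
by rewrite (negPf (valP g)).
Qed.

Lemma merge_pieces_old T (g : {f : edge G | f != e}) :
  (val g \in merge_pieces T) = (sub_old g \in T).
Proof. by rewrite in_merge_pieces valK. Qed.

Lemma merge_pieces_sub T :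
  (e \in merge_pieces T) = (sub_edge1 e \in T) && (sub_edge2 e \in T).
Proof. by rewrite in_merge_pieces insubF // eqxx. Qed.

Lemma merge_piecesD1 T h : merge_pieces (T :\ h) = merge_pieces T :\ base h.
Proof.
apply/setP=> f; rewrite !inE; apply/forallP/andP=> [Th | [fh /forallP Tf] h'].
  split; first by have:= Th h; rewrite !inE eqxx eq_sym; case: eqP.
  apply/forallP=> h'; apply/implyP=> hf.
  by have:= Th h'; rewrite hf !inE => /andP[].
apply/implyP=> hf; have:= Tf h'; rewrite hf !inE /= => ->; rewrite andbT.
by apply: contraNneq fh => <-; rewrite eq_sym.
Qed.

Lemma connect_merge_pieces T x y :
    connect (adjacent (merge_pieces T)) x y ->
  connect (@adjacent H T) (Some x) (Some y).
Proof.
apply: (connect_homo_edges (h := fun z => Some z : vertex H)).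
  exact: connectE_sym.
move=> f; rewrite in_merge_pieces; case: insubP => [g _ <- | /negPn/eqP-> ].
  exact: (@connect_edge H).
case/andP=> T1 T2; apply: (@connect_trans _ _ None).
  exact: (@connect_edge H _ _ T1).
exact: (@connect_edge H _ _ T2).
Qed.

(** The new vertex is sent to an end of [e] to which [T] joins it, if there is one. *)
Definition attach (T : {set edge H}) (x : vertex H) : vertex G :=
  if x is Some z then z else if sub_edge1 e \in T then src e else tgt e.

Lemma connect_attach T x y :
    connect (@adjacent H T) x y ->
  connect (adjacent (merge_pieces T)) (attach T x) (attach T y).
Proof.
apply: connect_homo_edges => [|[g|[]] Th]; first exact: connectE_sym.
- by apply: connect_edge; rewrite merge_pieces_old.
- rewrite /=; case: ifP => [T1|_]; last exact: connect0.
  by apply: connect_edge; rewrite merge_pieces_sub T1.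
by rewrite /= Th connect0.
Qed.

Lemma spans_subdivide T :
  @spans H T =
    ((sub_edge1 e \in T) || (sub_edge2 e \in T)) && spans (merge_pieces T).
Proof.
apply/spansP/andP=> [spT | [T12 /spansP spT]].
  split; last first.
    by apply/spansP=> x y; apply: (connect_attach (spT (Some x) (Some y))).
  have /connectP[[|x p] //= /andP[/adjacentP[[h b]] /= Th [def_h _] _] _] :=
    spT None (Some (src e)).
  by case: h b Th def_h => [g|[]] [] //= ->; rewrite ?orbT.
have con_attach x : connect (@adjacent H T) x (Some (attach T x)).
  case: x => [x|] /=; first exact: connect0.
  case: ifP T12 => [T1 _ | _ /= T2]; last exact: (@connect_edge H _ _ T2).
  by rewrite (@connectE_sym H); apply: (@connect_edge H _ _ T1).
move=> x y; apply: connect_trans (con_attach x) _; rewrite (@connectE_sym H).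
by apply: connect_trans (con_attach y) _; apply: connect_merge_pieces.
Qed.

(** Minimality passes both ways because deleting [h] from [T] deletes [base h] from the merged
    set. *)
Lemma spanning_tree_subdivide (T : {set edge H}) :
    (sub_edge1 e \in T) || (sub_edge2 e \in T) ->
  @spanning_tree H T = spanning_tree (merge_pieces T).
Proof.
move=> T12; rewrite !spanning_tree_min spans_subdivide T12 /=; congr (_ && _).
apply/forall_inP/forall_inP=> [minT f Tf | minT h Th].
  (* A piece [h] of [f] is chosen whose removal does not isolate the new vertex; for [f = e] both
     pieces are present and one remains. *)
  have: exists2 h, base h = f & (sub_edge1 e \in T :\ h) || (sub_edge2 e \in T :\ h).
    have [def_f|fe] := eqVneq f e; last first.
      by exists (inl (Sub f fe)); rewrite ?SubK // !inE.
    exists (sub_edge1 e) => //; move: Tf.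
    by rewrite def_f merge_pieces_sub !inE => /andP[_ ->]; rewrite orbT.
  case=> h def_f Th12; move: Tf; rewrite inE => /forallP/(_ h).
  rewrite def_f eqxx => /minT.
  by rewrite spans_subdivide Th12 merge_piecesD1 def_f.
rewrite spans_subdivide merge_piecesD1 negb_and.
(* In the second case [h] is the only new edge in [T], so removing it isolates the new vertex. *)
have [/minT->|h_T] := boolP (base h \in merge_pieces T); first exact: orbT.
rewrite negb_or; case: h Th h_T => [g|[]] Th; rewrite /= ?merge_pieces_sub.
- by rewrite merge_pieces_old Th.
- by rewrite !inE Th andbT => /negPf->; rewrite andbF.
by rewrite !inE Th /= => /negPf->.
Qed.

(** * Degrees in the subdivided graph *)

Lemma big_old_edges (A : Type) (idx : A) (op : Monoid.com_law idx)
    (P : pred (edge G)) (F : edge G -> A) :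
  \big[op/idx]_(g : {f : edge G | f != e} | P (val g)) F (val g) =
  \big[op/idx]_(f | (f != e) && P f) F f.
Proof. exact: esym (@big_sub_cond _ _ op _ [pred f | f != e] P F). Qed.

(** The edge [e] gives way to two new ones; [Q e] stands on the left to avoid a subtraction. *)
Lemma card_subdivide (P : pred (edge H)) (Q : pred (edge G)) :
    (forall g, P (sub_old g) = Q (val g)) ->
  (#|[set h | P h]| + Q e
    = #|[set f | Q f]| + (P (sub_edge1 e) + P (sub_edge2 e)))%N.
Proof.
move=> defP; rewrite (cardsD1 e [set f | _]) inE -!sum1dep_card big_sumType /=.
rewrite [in LHS](eq_bigl (fun g => Q (val g))) //.
rewrite (big_old_edges _ Q (fun=> 1%N)).
rewrite [X in (_ + X + _)%N]big_mkcond big_bool /=.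
rewrite [X in (Q e + X)%N](eq_bigl (fun f => (f != e) && Q f)) => [|f].
  rewrite /sub_edge1 /sub_edge2; set m := bigop _ _ _.
  by case: (P (inr true)); case: (P (inr false)); lia.
by rewrite !inE.
Qed.

Lemma deg_subdivide_old (x : vertex G) : @deg H (Some x) = deg x.
Proof.
rewrite /deg; congr addn.
  have:= @card_subdivide (fun h => src h == Some x) (fun f => src f == x) (fun=> erefl).
  by rewrite [src (sub_edge2 e) == _]/= addn0 => /addIn.
have:= @card_subdivide (fun h => tgt h == Some x) (fun f => tgt f == x) (fun=> erefl).
by rewrite [tgt (sub_edge1 e) == _]/= add0n => /addIn.
Qed.

Lemma deg_subdivide_new : @deg H None = 2%N.
Proof.
rewrite /deg (_ : [set h | src h == _] = [set sub_edge2 e]); last first.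
  by apply/setP=> -[g|[]]; rewrite !inE.
rewrite (_ : [set h | tgt h == _] = [set sub_edge1 e]) ?cards1 //.
by apply/setP=> -[g|[]]; rewrite !inE.
Qed.

(** * Tree weights in the subdivided graph *)

Definition split_pieces (b1 b2 : bool) (S : {set edge G}) : {set edge H} :=
  [set h | match h with inl g => val g \in S | inr b => if b then b2 else b1 end].

Lemma split_piecesK b1 b2 S :
  (merge_pieces (split_pieces b1 b2 S) == S) = ((e \in S) == b1 && b2).
Proof.
apply/eqP/eqP=> [{1}<-|eS]; first by rewrite merge_pieces_sub !inE.
apply/setP=> f; have [->|fe] := eqVneq f e; first by rewrite merge_pieces_sub !inE.
by rewrite -[f](SubK {f : edge G | f != e} fe) merge_pieces_old inE.
Qed.

Lemma merge_piecesK (T : {set edge H}) :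
  split_pieces (sub_edge1 e \in T) (sub_edge2 e \in T) (merge_pieces T) = T.
Proof.
by apply/setP=> -[g|[]]; rewrite inE ?merge_pieces_old.
Qed.

Variables (R : realFieldType) (l : edge G -> R) (l' : edge H -> R).
Hypothesis l'_old : forall f : {f : edge G | f != e}, l' (sub_old f) = l (val f).

Lemma prod_split_pieces b1 b2 S :
  \prod_(h | h \notin split_pieces b1 b2 S) l' h =
    (if b1 then 1 else l' (sub_edge1 e)) * (if b2 then 1 else l' (sub_edge2 e))
    * \prod_(f | (f != e) && (f \notin S)) l f.
Proof.
rewrite mulrC big_sumType; congr (_ * _).
  rewrite -(big_old_edges _ (fun f => f \notin S)).
  by apply: eq_big => g; rewrite ?inE // => _; apply: l'_old.
rewrite big_mkcond big_bool /= !inE mulrC.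
by case: b1 b2 => [] [].
Qed.

(* The factor of [e] is left out of the weight, so that the trees avoiding   *)
(* [e] have total weight [l e * tree_sum false].                              *)
Definition tree_sum (b : bool) : R :=
  \sum_(S : {set edge G} | spanning_tree S && ((e \in S) == b))
    \prod_(f | (f != e) && (f \notin S)) l f.

(** Once the status of both new edges is fixed, merging is a bijection onto the trees of [G] whose
    status at [e] is [b1 && b2]. *)
Lemma sum_split_pieces b1 b2 : b1 || b2 ->
  \sum_(T : {set edge H} | [&& spanning_tree T, (sub_edge1 e \in T) == b1
                & (sub_edge2 e \in T) == b2]) \prod_(h | h \notin T) l' h =
    (if b1 then 1 else l' (sub_edge1 e)) * (if b2 then 1 else l' (sub_edge2 e))
    * tree_sum (b1 && b2).
Proof.
move=> b12; rewrite /tree_sum (reindex_onto (split_pieces b1 b2) merge_pieces) /=; last first.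
  by move=> T /and3P[_ /eqP<- /eqP<-]; apply: merge_piecesK.
rewrite mulr_sumr; apply: eq_big => [S | S _]; last exact: prod_split_pieces.
rewrite split_piecesK !inE !eqxx !andbT; case: eqP => [eS | _]; last by rewrite !andbF.
have def_S: merge_pieces (split_pieces b1 b2 S) = S.
  by apply/eqP; rewrite split_piecesK eS.
by rewrite spanning_tree_subdivide ?inE // def_S.
Qed.

Lemma tau_through_tree_sum : tau_through e l = tree_sum true.
Proof.
apply: eq_big => [S | S /andP[_ Se]]; first by rewrite eqb_id.
by apply: eq_bigl => f; case: eqVneq => [->|//]; rewrite Se.
Qed.

Lemma tau_tree_sum : tau l = tree_sum true + l e * tree_sum false.
Proof.
rewrite -tau_through_tree_sum /tau (bigID (fun S : {set edge G} => e \in S)) /=; congr (_ + _).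
rewrite mulr_sumr; apply: eq_big => [S | S /andP[_ Se]]; first by rewrite eqbF_neg.
rewrite (bigD1 e) //=; congr (_ * _).
by apply: eq_bigl => f; rewrite andbC.
Qed.

Lemma tau_through_sub_edge1 :
  tau_through (sub_edge1 e) l' = tree_sum true + l' (sub_edge2 e) * tree_sum false.
Proof.
have:= sum_split_pieces (isT : true || true).
have:= sum_split_pieces (isT : true || false).
rewrite /= !mul1r => <- <-.
rewrite /tau_through (bigID (fun T : {set edge H} => sub_edge2 e \in T)) /=.
by congr (_ + _); apply: eq_bigl => T; rewrite ?eqbF_neg ?eqb_id andbA.
Qed.

Lemma tau_through_sub_edge2 :
  tau_through (sub_edge2 e) l' = tree_sum true + l' (sub_edge1 e) * tree_sum false.
Proof.
have:= sum_split_pieces (isT : true || true).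
have:= sum_split_pieces (isT : false || true).
rewrite /= !mul1r !mulr1 => <- <-.
rewrite /tau_through (bigID (fun T : {set edge H} => sub_edge1 e \in T)) /=.
by congr (_ + _); apply: eq_bigl => T; rewrite ?eqbF_neg ?eqb_id andbAC andbA.
Qed.

Lemma tau_subdivide :
    l' (sub_edge1 e) + l' (sub_edge2 e) = l e -> tau l' = tau l.
Proof.
(* The total is regrouped as the weight of the trees through [sub_edge1 e] plus
   [l' (sub_edge1 e) * tree_sum false], the weight of those avoiding it. *)
move=> sum_l'; rewrite tau_tree_sum -sum_l' mulrDl [_ + l' _ * _]addrC addrA.
rewrite -tau_through_sub_edge1.
rewrite /tau (bigID (fun T : {set edge H} => sub_edge1 e \in T)) /=; congr (_ + _).
have:= sum_split_pieces (isT : false || true).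
rewrite /= mulr1 => <-; apply: eq_bigl => T; rewrite eqbF_neg eqb_id.
(* A tree without [sub_edge1 e] must reach the new vertex through [sub_edge2 e]. *)
case trT: (@spanning_tree H T) => //=; case T1: (sub_edge1 e \in T) => //=.
by apply/esym; move/spanning_tree_spans: trT; rewrite spans_subdivide T1 => /andP[].
Qed.

End Subdivision.

Theorem theorem3p15 (R : realFieldType) (G : graph) (l : edge G -> R)
    (e : edge G) (l' : edge (subdivide e) -> R)
    (G_connected : connected G)
    (l_pos : forall f : edge G, 0 < l f)
    (l'_old : forall f : {f : edge G | f != e}, l' (sub_old f) = l (val f))
    (l'_pos1 : 0 < l' (sub_edge1 e))
    (l'_pos2 : 0 < l' (sub_edge2 e))
    (l'_sum : l' (sub_edge1 e) + l' (sub_edge2 e) = l e) :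
  ricci_foster l e = ricci_foster l' (sub_edge1 e) + ricci_foster l' (sub_edge2 e).
Proof.
have l'_pos h : 0 < l' h by case: h => [g|[]] //; rewrite (l'_old g).
have tau_n0: tau l != 0 by rewrite gt_eqF // tau_gt0.
rewrite /ricci_foster !eff_res_through // !deg_subdivide_old !deg_subdivide_new.
rewrite (tau_subdivide l'_old l'_sum) (tau_through_sub_edge1 l'_old).
rewrite (tau_through_sub_edge2 l'_old) tau_through_tree_sum.
move: tau_n0; rewrite (tau_tree_sum e) -l'_sum => tau_n0.
(* The old degree terms agree on both sides and are made opaque; [tau] is the only denominator left
   besides 2. *)
set du := _%:R^-1; set dv := (deg (tgt e))%:R^-1.
by field.
Qed.
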